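(* Let $\mathcal{H}$ be a complex Hilbert space and $T:\mathcal{H}\to\mathcal{H}$ a bounded linear operator. Suppose there exists a bounded linear operator $S$ on $\mathcal{H}$ such that $S^2\neq 0$, $TS=ST$ and $T^*T\geq S^*S+I$. Then $T$ is not $1$-weakly hypercyclic.
   Context: For self-adjoint operators, $A\geq B$ means $\langle (A-B)x,x\rangle\geq 0$ for all $x\in\mathcal{H}$; $T^*$ is the Hilbert space adjoint. For $n\in\mathbb{N}$, a bounded operator $T$ on a Banach space $X$ over $\mathbb{K}$ is $n$-weakly hypercyclic if there is $x\in X$ such that for every continuous surjective linear map $L:X\to\mathbb{K}^n$, the set $\{L(T^mx):m\in\mathbb{Z}_+\}$ is dense in $\mathbb{K}^n$. *)

(* Defs.v *)
From HB Require Import structures.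
From mathcomp Require Import all_boot all_order all_algebra.
From mathcomp Require Import all_classical all_reals all_analysis.
From mathcomp.real_closed Require Import complex.
Import Order.TTheory GRing.Theory Num.Theory.
Import numFieldNormedType.Exports.

Set Implicit Arguments.
Unset Strict Implicit.
Unset Printing Implicit Defensive.

Local Open Scope ring_scope.
Local Open Scope classical_set_scope.

(* [ip] is an inner product on the complex normed space V inducing its norm:
   linear in the first argument, conjugate symmetric, and <x,x> = |x|^2.
   Together with completeness of V this makes V a complex Hilbert space. *)
Definition is_inner_product (R : realType) (V : normedModType R[i])
    (ip : V -> V -> R[i]) : Prop :=
  [/\ forall (a : R[i]) (x y z : V), ip (a *: x + y) z = a * ip x z + ip y z,
      forall x y : V, ip y x = (ip x y)^*
    & forall x : V, ip x x = `|x| ^+ 2].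

Definition adjoint (R : realType) (V : normedModType R[i])
    (ip : V -> V -> R[i]) (T : V -> V) : V -> V :=
  fun y => xget 0 [set z | forall x, ip (T x) y = ip x z].

Definition n_weakly_hypercyclic (R : realType) (V : normedModType R[i])
    (n : nat) (T : V -> V) : Prop :=
  exists x : V, forall L : {linear V -> 'rV[R[i]^o]_n},
    continuous L -> (forall y, exists v, L v = y) ->
    dense (range (fun m : nat => L (iter m T x))).

(* Main.v *)
(* If S^2 x = 0, the orbit of x stays in the kernel of S^2, which is killed by
   the nonzero functional <S^2 ., S^2 w>. Otherwise |T v|^2 >= |S v|^2 + |v|^2
   and TS = ST give, by iteration, |T^n x|^2 >= |x|^2 + n(n-1)/2 |S^2 x|^2, so
   that |T^n x| grows at least linearly. The weights t_n = 1/(n+1) being square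
   summable, a weak form of Ball's complex plank theorem then provides a bounded
   functional f with |f (T^n x)| bounded away from 0.

   For finitely many vectors x_k, the plank theorem is obtained by (almost)
   maximizing prod_k |<z, x_k>|^(p_k) over the unit sphere and comparing z with
   z + l u, where u is the component of x_j orthogonal to z and l runs over a
   circle. Infinitely many vectors are handled by taking the limit of the
   functionals <., z_n> along an ultrafilter. *)
Require Import Defs.
From HB Require Import structures.
From mathcomp Require Import all_boot all_order all_algebra.
From mathcomp Require Import all_classical all_reals all_analysis.
From mathcomp.real_closed Require Import complex.
From mathcomp Require Import separable cyclic cyclotomic.
From mathcomp Require Import ring lra.
Import Order.TTheory GRing.Theory Num.Theory.
Import numFieldNormedType.Exports.
Local Open Scope ring_scope.

Set Implicit Arguments.
Unset Strict Implicit.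
Unset Printing Implicit Defensive.

Local Notation Re := complex.Re.
Local Notation Im := complex.Im.

(** * Roots of unity and the maximum modulus principle for polynomials *)

Lemma prim_root_exists (C : numClosedFieldType) (n : nat) : (0 < n)%N ->
  exists z : C, n.-primitive_root z.
Proof.
move=> n_gt0; pose p : {poly C} := 'X^n - 1.
have [r Dp] := closed_field_poly_normal p.
have sz_p : size p = n.+1 by rewrite size_XnsubC.
have p0 : p != 0 by rewrite -size_poly_gt0 sz_p.
rewrite (monicP _) ?monicXnsubC // scale1r in Dp.
have sz_r : size r = n by apply: succn_inj; rewrite -sz_p Dp size_prod_XsubC.
have : has n.-primitive_root r.
  apply: has_prim_root => //.
  - apply/allP => z; rewrite -root_prod_XsubC -Dp => /rootP.
    by rewrite !hornerE => /eqP; rewrite subr_eq0 unity_rootE.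
  - by rewrite -separable_prod_XsubC -Dp separable_Xn_sub_1 // pnatr_eq0 -lt0n.
  - by rewrite sz_r.
by case/hasP=> z _ zn; exists z.
Qed.

(* The mean of p over the n-th roots of unity scaled by r is p.[0]. *)
Lemma max_modulus_circle (C : numClosedFieldType) (p : {poly C}) (r : C) :
  exists2 w : C, `|w| = 1 & `|p.[0]| <= `|p.[r * w]|.
Proof.
(* The successor keeps [n] positive even for p = 0. No exponent strictly between 0 and [n] is
   divisible by [n], so only the constant term survives the averaging. *)
pose n := (size p).+1; have [z zn] := @prim_root_exists C n isT.
have zX i : `|z ^+ i| = 1.
  have z1 : `|z| = 1.
    apply/eqP; rewrite -(@pexpr_eq1 _ _ n) // -normrX.
    by rewrite (prim_expr_order zn) normr1.
  by rewrite normrX z1 expr1n.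
have meanE : \sum_(j < n) p.[r * z ^+ j] = n%:R * p.[0].
  under eq_bigr do rewrite (@horner_coef_wide _ n) //.
  rewrite exchange_big /= horner_coef0 big_ord_recl /=.
  rewrite [X in _ + X]big1 ?addr0 => [|i _].
    rewrite (eq_bigr (fun=> p`_0)) => [|j _]; last by rewrite mulr1.
    by rewrite sumr_const card_ord mulr_natl.
  under eq_bigr do rewrite exprMn mulrA -exprM mulnC exprM.
  rewrite -mulr_sumr; set y := z ^+ _.
  suff -> : \sum_(j < n) y ^+ j = 0 by rewrite mulr0.
  have y1 : y - 1 != 0.
    rewrite subr_eq0 -(prim_order_dvd zn) /bump /= add1n.
    by apply/negP => /dvdn_leq /= /(_ isT); rewrite leqNgt ltnS ltn_ord.
  apply: (mulfI y1); rewrite -subrX1 mulr0.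
  by rewrite -exprM mulnC exprM (prim_expr_order zn) expr1n subrr.
have [/existsP[j /= pj]|/existsPn none] :=
    boolP [exists j : 'I_n, `|p.[0]| <= `|p.[r * z ^+ j]|].
  by exists (z ^+ j).
have : `|n%:R * p.[0]| < n%:R * `|p.[0]|.
  rewrite -meanE; apply: le_lt_trans (ler_norm_sum _ _ _) _.
  rewrite mulr_natl -[n in ltRHS]card_ord -sumr_const.
  apply: ltr_sum => [|j _].
    by apply/hasP; exists ord0; rewrite ?mem_index_enum.
  by have := none j; rewrite -real_ltNge ?normr_real.
by rewrite normrM normr_nat ltxx.
Qed.

Lemma nonroot_exists (F : numDomainType) (p : {poly F}) :
  p != 0 -> exists x : F, p.[x] != 0.
Proof.
move=> p0; apply: contrapT => none.
suff : (size [seq i%:R : F | i <- iota 0 (size p)] < size p)%N.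
  by rewrite size_map size_iota ltnn.
apply: max_poly_roots => //.
  by apply/allP => x _; apply: contrapT => px; apply: none; exists x; apply/negP.
by rewrite map_inj_uniq ?iota_uniq // => i j /eqP; rewrite eqr_nat => /eqP.
Qed.

(** * Real-valued norms *)

Section RealNorm.
Context {R : realType}.

(** A norm over [R[i]] is itself a complex number. Its real part loses nothing and lives in [R],
    where suprema, square roots and [lra] are available. *)
Definition rnorm {V : normedZmodType R[i]} (v : V) : R := Re `|v|.

Section NormedZmod.
Context {V : normedZmodType R[i]}.
Implicit Types v w : V.

Lemma rnormE v : `|v| = (rnorm v)%:C%C.
Proof. by rewrite RRe_real ?normr_real. Qed.

Lemma rnorm_ge0 v : 0 <= rnorm v.
Proof. by rewrite -ler0c -rnormE. Qed.

Lemma rnorm0 : rnorm (0 : V) = 0.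
Proof. by rewrite /rnorm normr0. Qed.

Lemma rnorm_eq0 v : (rnorm v == 0) = (v == 0).
Proof. by rewrite -[RHS]normr_eq0 rnormE -(inj_eq (@complexI R)). Qed.

Lemma rnorm_gt0 v : (0 < rnorm v) = (v != 0).
Proof. by rewrite lt_def rnorm_ge0 andbT rnorm_eq0. Qed.

Lemma rnormN v : rnorm (- v) = rnorm v.
Proof. by rewrite /rnorm normrN. Qed.

Lemma rnormB v w : rnorm (v - w) = rnorm (w - v).
Proof. by rewrite -rnormN opprB. Qed.

End NormedZmod.

Lemma rnormZ (V : normedModType R[i]) (a : R[i]) (v : V) :
  rnorm (a *: v) = rnorm a * rnorm v.
Proof. by apply: complexI; rewrite rmorphM /= -!rnormE normrZ. Qed.

Implicit Types a b : R[i].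

Lemma rnorm1 : rnorm (1 : R[i]) = 1.
Proof. by rewrite /rnorm normr1. Qed.

Lemma rnormM a b : rnorm (a * b) = rnorm a * rnorm b.
Proof. by apply: complexI; rewrite rmorphM /= -!rnormE normrM. Qed.

Lemma rnormX a n : rnorm (a ^+ n) = rnorm a ^+ n.
Proof. by apply: complexI; rewrite rmorphXn /= -!rnormE normrX. Qed.

Lemma rnorm_prod (I : Type) (s : seq I) (P : pred I) (F : I -> R[i]) :
  rnorm (\prod_(i <- s | P i) F i) = \prod_(i <- s | P i) rnorm (F i).
Proof. exact: (big_morph _ rnormM rnorm1). Qed.

Lemma rnormC a : rnorm a^* = rnorm a.
Proof. by rewrite /rnorm norm_conjC. Qed.

Lemma rnorm_real (x : R) : rnorm x%:C%C = `|x|.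
Proof. by rewrite /rnorm normc_def /= expr0n addr0 sqrtr_sqr. Qed.

Lemma rnorm_sqr a : rnorm a ^+ 2 = Re a ^+ 2 + Im a ^+ 2.
Proof. by apply: complexI; rewrite add_Re2_Im2 rnormE rmorphXn. Qed.

Lemma ler_Re_rnorm a : `|Re a| <= rnorm a.
Proof. by rewrite -lecR -rnormE normc_ge_Re. Qed.

Lemma ler_Im_rnorm a : `|Im a| <= rnorm a.
Proof.
rewrite -[leLHS]normr_id; apply: (@le_trans _ _ `|Re (a * 'i%C)|).
  by rewrite ReiNIm normrN normr_id.
apply: le_trans (ler_Re_rnorm _) _.
by rewrite rnormM {2}/rnorm normc_def /= !(expr0n, expr1n, add0r, sqrtr1, mulr1).
Qed.

Lemma mulCJ a : a * a^* = (rnorm a ^+ 2)%:C%C.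
Proof. by rewrite -normCK rnormE rmorphXn. Qed.

End RealNorm.

(** * Inner product identities and the Cauchy-Schwarz inequality *)

Section InnerProduct.
Context {R : realType} {V : normedModType R[i]} {ip : V -> V -> R[i]}.
Hypothesis hip : is_inner_product ip.
Implicit Types x y z : V.

Lemma ipC x y : ip y x = (ip x y)^*. Proof. by case: hip. Qed.

Lemma ip0l y : ip 0 y = 0.
Proof.
have [lin _ _] := hip; have := lin (-1) 0 0 y.
by rewrite scaler0 addr0 mulN1r addNr.
Qed.

Lemma ipDl x y z : ip (x + y) z = ip x z + ip y z.
Proof. by have [lin _ _] := hip; rewrite -[x in LHS]scale1r lin mul1r. Qed.

Lemma ipZl a x y : ip (a *: x) y = a * ip x y.
Proof. by have [lin _ _] := hip; rewrite -[a *: x]addr0 lin ip0l addr0. Qed.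

Lemma ipNl x y : ip (- x) y = - ip x y.
Proof. by rewrite -scaleN1r ipZl mulN1r. Qed.

Lemma ipBl x y z : ip (x - y) z = ip x z - ip y z.
Proof. by rewrite ipDl ipNl. Qed.

Lemma ipDr x y z : ip x (y + z) = ip x y + ip x z.
Proof. by rewrite ipC ipDl rmorphD /= -!ipC. Qed.

Lemma ipZr a x y : ip x (a *: y) = a^* * ip x y.
Proof. by rewrite ipC ipZl rmorphM /= -ipC. Qed.

Lemma ipNr x y : ip x (- y) = - ip x y.
Proof. by rewrite ipC ipNl rmorphN /= -ipC. Qed.

Lemma ipBr x y z : ip x (y - z) = ip x y - ip x z.
Proof. by rewrite ipDr ipNr. Qed.

Lemma ipxx x : ip x x = (rnorm x ^+ 2)%:C%C.
Proof. by have [_ _ ->] := hip; rewrite rnormE rmorphXn. Qed.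

Lemma rnorm_ipC x y : rnorm (ip y x) = rnorm (ip x y).
Proof. by rewrite ipC rnormC. Qed.

Lemma sqr_rnormD x y :
  rnorm (x + y) ^+ 2 = rnorm x ^+ 2 + rnorm y ^+ 2 + 2 * Re (ip x y).
Proof.
have := ipxx (x + y); rewrite ipDl !ipDr !ipxx (ipC x y).
case: (ip x y) => a b /= [<- _]; ring.
Qed.

Lemma parallelogram x y :
  rnorm (x + y) ^+ 2 + rnorm (x - y) ^+ 2 =
  2 * (rnorm x ^+ 2 + rnorm y ^+ 2).
Proof.
rewrite !sqr_rnormD rnormN ipNr.
by case: (ip x y) => a b /=; ring.
Qed.

Lemma pythagoras x y : ip x y = 0 ->
  rnorm (x + y) ^+ 2 = rnorm x ^+ 2 + rnorm y ^+ 2.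
Proof. by move=> xy0; rewrite sqr_rnormD xy0 /= mulr0 addr0. Qed.

Lemma cauchy_schwarz x y : rnorm (ip x y) <= rnorm x * rnorm y.
Proof.
have [->|y0] := eqVneq y 0; first by rewrite rnorm_ipC ip0l !rnorm0 mulr0.
have ny : 0 < rnorm y by rewrite rnorm_gt0.
pose c := ip x y / (rnorm y ^+ 2)%:C%C.
have py : ip (x - c *: y) (c *: y) = 0.
  rewrite ipZr ipBl ipZl ipxx divfK ?subrr ?mulr0 //.
  by rewrite (inj_eq (@complexI R) _ 0) expf_eq0 rnorm_eq0 negb_and y0 orbT.
have := pythagoras py; rewrite subrK rnormZ => xE.
have {xE} : (rnorm c * rnorm y) ^+ 2 <= rnorm x ^+ 2.
  by rewrite xE lerDr sqr_ge0.
rewrite ler_sqr ?nnegrE ?mulr_ge0 ?rnorm_ge0 // => cx.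
have -> : ip x y = c * (rnorm y ^+ 2)%:C%C.
  rewrite divfK // (inj_eq (@complexI R) _ 0) expf_eq0 rnorm_eq0 negb_and y0.
  by rewrite orbT.
rewrite rnormM rnorm_real ger0_norm ?sqr_ge0 // expr2 mulrA.
by rewrite ler_pM2r.
Qed.

End InnerProduct.

(** * The plank theorem for finitely many vectors *)

Section Plank.
Context {R : realType} {V : normedModType R[i]} {ip : V -> V -> R[i]}.
Hypothesis hip : is_inner_product ip.
Context {n : nat} {x : 'I_n -> V} {p : 'I_n -> nat}.
Hypothesis x_neq0 : forall k, x k != 0.
Hypothesis p_gt0 : forall k, (0 < p k)%N.

(** Search on the curve z = sum_k t^k x_k. Each <z, x_j> is a polynomial in t, nonzero because its
    coefficient of t^j is |x_j|^2, so some t avoids the roots of all of them. *)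
Lemma nonorthogonal_exists : exists z, forall k, ip z (x k) != 0.
Proof.
pose q j : {poly R[i]} := \sum_k ip (x k) (x j) *: 'X^k.
have q0 j : q j != 0.
  apply/eqP => /(congr1 (fun q : {poly _} => q`_j)).
  rewrite coef0 coef_sum (bigD1 j) //= coefZ coefXn eqxx mulr1 big1 => [|k kj].
    rewrite addr0 (ipxx hip) => /eqP; apply/negP.
    by rewrite (inj_eq (@complexI R) _ 0) expf_eq0 rnorm_eq0 (negbTE (x_neq0 _)).
  rewrite coefZ coefXn [(j : nat) == k]eq_sym (inj_eq val_inj).
  by rewrite (negbTE kj) mulr0.
have [t] : exists t, (\prod_j q j).[t] != 0.
  by apply: nonroot_exists; apply/prodf_neq0 => j _.
rewrite horner_prod => /prodf_neq0 qt; exists (\sum_(k < n) t ^+ k *: x k) => j.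
rewrite (big_morph (ip^~ (x j)) (fun y y' => ipDl hip y y' _) (ip0l hip _)).
have := qt j isT; rewrite horner_sum; apply: contra_neq => ipt; rewrite -[RHS]ipt.
by apply: eq_bigr => k _; rewrite (ipZl hip) hornerZ hornerXn mulrC.
Qed.

(** The objective, homogeneous of degree [N]. The ratios p_k / N sum to 1 and stand for the squared
    plank widths; integral exponents make F, along a complex line, the modulus of a polynomial. *)
Let F z := \prod_k rnorm (ip z (x k)) ^+ p k.
Let N := (\sum_k p k)%N.

Let FZ (a : R[i]) z : F (a *: z) = rnorm a ^+ N * F z.
Proof.
rewrite /N expr_sum -big_split; apply: eq_bigr => k _.
by rewrite (ipZl hip) rnormM exprMn.
Qed.

(** The unit sphere need not be compact, so the supremum may not be attained. A point exceeding half
    of it is enough, at the price of the factor 2. *)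
Lemma near_maximizer_exists : (0 < n)%N ->
  exists z, [/\ rnorm z = 1, 0 < F z
    & forall y, y != 0 -> F y <= 2 * F z * rnorm y ^+ N].
Proof.
move=> n_gt0; pose S : set R := [set F z | z in [set z | rnorm z = 1]]%classic.
have normed y : y != 0 -> S (F y / rnorm y ^+ N).
  move=> y0; exists (((rnorm y)^-1)%:C%C *: y).
    rewrite /= rnormZ rnorm_real ger0_norm ?invr_ge0 ?rnorm_ge0 //.
    by rewrite mulVf ?rnorm_eq0.
  by rewrite FZ rnorm_real ger0_norm ?invr_ge0 ?rnorm_ge0 // exprVn mulrC.
have [z0 z0x] := nonorthogonal_exists.
have z0_neq0 : z0 != 0.
  by apply: contraTneq (z0x (Ordinal n_gt0)) => ->; rewrite (ip0l hip) eqxx.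
have Fz0 : 0 < F z0 / rnorm z0 ^+ N.
  rewrite divr_gt0 ?exprn_gt0 ?rnorm_gt0 // prodr_gt0 // => k _.
  by rewrite exprn_gt0 ?rnorm_gt0.
have hS : has_sup S.
  split; first by exists (F z0 / rnorm z0 ^+ N); exact: normed.
  exists (\prod_k rnorm (x k) ^+ p k) => _ [z /= z1 <-].
  apply: ler_prod => k _; rewrite exprn_ge0 ?rnorm_ge0 //=.
  rewrite lerXn2r ?nnegrE ?rnorm_ge0 //.
  by have := cauchy_schwarz hip z (x k); rewrite z1 mul1r.
have supS y : y != 0 -> F y / rnorm y ^+ N <= sup S.
  by move=> y0; apply: sup_upper_bound => //; exact: normed.
have sup_gt0 : 0 < sup S by exact: lt_le_trans Fz0 (supS _ z0_neq0).
have sup2_gt0 : 0 < sup S / 2 by lra.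
have [_ [z /= z1 <-] Fz] := sup_adherent sup2_gt0 hS.
exists z; split=> // [|y y0]; first by lra.
rewrite -ler_pdivrMr ?exprn_gt0 ?rnorm_gt0 //.
by apply: le_trans (supS _ y0) _; lra.
Qed.

(** With u the component of x_j orthogonal to z and w = |u|^2, one has |x_j|^2 = w + |b|^2, so it is
    s w that needs a bound. The exponents [N] and p_j are reconciled by (1 + s)^N <= exp(s N) =
    e^(p_j), which leaves constants free of p_j after taking p_j-th roots. *)
Let near_maximizer_bound z j : rnorm z = 1 -> 0 < F z ->
  (forall y, y != 0 -> F y <= 2 * F z * rnorm y ^+ N) ->
  (p j)%:R / N%:R * rnorm (x j) ^+ 2 <=
    (4 * expR 1 + 1) * rnorm (ip z (x j)) ^+ 2.
Proof.
move=> z1 Fz_gt0 Fmax; set b := ip z (x j); set s := _ / _.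
have pN : (p j <= N)%N by rewrite /N (bigD1 j) //= leq_addr.
have N_gt0 : (0 < N)%N by apply: leq_trans pN.
have s_gt0 : 0 < s by rewrite divr_gt0 ?ltr0n.
have s_le1 : s <= 1 by rewrite ler_pdivrMr ?ltr0n // mul1r ler_nat.
have [u xjE] : exists u, x j = u + b^* *: z.
  by exists (x j - b^* *: z); rewrite subrK.
have [w wE] : exists w, w = rnorm u ^+ 2 by exists (rnorm u ^+ 2).
have uz : ip u z = 0.
  have := ipC hip z (x j); rewrite -/b xjE (ipDl hip) (ipZl hip) (ipxx hip) z1.
  by rewrite expr1n mulr1 => /eqP; rewrite -subr_eq0 addrK => /eqP.
have zu : ip z u = 0 by rewrite (ipC hip) uz conjC0.
have uw : ip u (x j) = w%:C%C.
  by rewrite xjE (ipDr hip) (ipZr hip) uz mulr0 addr0 (ipxx hip) wE.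
have xE : rnorm (x j) ^+ 2 = w + rnorm b ^+ 2.
  rewrite xjE (pythagoras hip) ?(ipZr hip) ?uz ?mulr0 //.
  by rewrite rnormZ z1 mulr1 rnormC wE.
have e_gt0 := expR_gt0 (1 : R).
have b2_ge0 := sqr_ge0 (rnorm b).
(* The summand 1 in 4e + 1 absorbs s |b|^2, as s <= 1. *)
rewrite xE; suff : s * w <= 4 * expR 1 * rnorm b ^+ 2 by nra.
have [->|w0] := eqVneq w 0; first by rewrite mulr0; nra.
have w_gt0 : 0 < w by rewrite lt_def w0 wE sqr_ge0.
(* This radius gives |z + l u|^2 = 1 + s whenever |l| = r. *)
pose r := Num.sqrt (s / w).
have r_gt0 : 0 < r by rewrite sqrtr_gt0 divr_gt0.
have rw_gt0 := mulr_gt0 r_gt0 w_gt0.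
have r2 : r ^+ 2 * w = s by rewrite sqr_sqrtr ?divfK // divr_ge0 // ltW.
pose G y := \prod_(k | k != j) rnorm (ip y (x k)) ^+ p k.
have FG y : F y = rnorm (ip y (x j)) ^+ p j * G y by rewrite /F (bigD1 j).
have Gz_gt0 : 0 < G z.
  have := Fz_gt0; rewrite FG; have := exprn_ge0 (p j) (rnorm_ge0 (ip z (x j))).
  rewrite le_eqVlt => /predU1P[<-|/pmulr_rgt0 -> //].
  by rewrite mul0r ltxx.
(* On |l| = r the factor b + l w of the j-th inner product has the modulus of
   its reflection r w + l b^*/r, which is large at the centre. *)
pose q : {poly R[i]} := ((b^* / r%:C%C) *: 'X + (r * w)%:C%C%:P) ^+ p j *
  \prod_(k | k != j) ((ip u (x k)) *: 'X + (ip z (x k))%:P) ^+ p k.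
have [t t1 qt] := max_modulus_circle q r%:C%C.
pose y := z + (r%:C%C * t) *: u.
have rt1 : rnorm t = 1 by rewrite /rnorm t1.
have y2 : rnorm y ^+ 2 = 1 + s.
  rewrite (pythagoras hip) ?(ipZr hip) ?zu ?mulr0 // z1 rnormZ rnormM rt1.
  by rewrite rnorm_real gtr0_norm // mulr1 exprMn -wE r2 expr1n.
have y0 : y != 0 by rewrite -rnorm_eq0 -sqrf_eq0 y2; lra.
have q0E : rnorm q.[0] = (r * w) ^+ p j * G z.
  rewrite hornerM horner_exp hornerD hornerZ hornerX hornerC horner_prod.
  rewrite mulr0 add0r rnormM rnormX rnorm_real.
  rewrite (gtr0_norm rw_gt0) rnorm_prod; congr (_ * _).
  apply: eq_bigr => k _; rewrite horner_exp hornerD hornerZ hornerX hornerC.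
  by rewrite mulr0 add0r rnormX.
have qtE : rnorm q.[r%:C%C * t] = F y.
  rewrite FG hornerM horner_exp hornerD hornerZ hornerX hornerC horner_prod.
  rewrite rnormM rnormX rnorm_prod.
  congr (_ ^+ _ * _); last first.
    apply: eq_bigr => k _; rewrite horner_exp hornerD hornerZ hornerX hornerC.
    by rewrite rnormX /y (ipDl hip) (ipZl hip) addrC [ip _ _ * _]mulrC.
  rewrite /y (ipDl hip) (ipZl hip) uw -/b.
  (* Multiplying b + r t w by the unimodular t^* and conjugating gives t b^* + r w, the first factor
     of [q] at r t. *)
  rewrite -[RHS]mul1r -rt1 -[rnorm t]rnormC -rnormM mulrDr.
  have rC0 : r%:C%C != 0 by rewrite (inj_eq (@complexI R) _ 0) gt_eqF.
  rewrite mulrA divfK // -[LHS]rnormC; congr rnorm.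
  rewrite rmorphD rmorphM /= conjCK mulrC; congr (_ + _).
  rewrite [r%:C%C * t]mulrC -mulrA [RHS]mulrA [t^* * t]mulrC mulCJ rt1.
  by rewrite expr1n mul1r -rmorphM; exact: conjc_real.
(* Maximum modulus gives |q(0)| <= F y and near-maximality gives F y <= 2 F z |y|^N; the positive
   factor G z common to both ends cancels. *)
have key : (r * w) ^+ p j <= 2 * rnorm b ^+ p j * rnorm y ^+ N.
  rewrite -(ler_pM2r Gz_gt0) -q0E; 
  apply: le_trans (_ : rnorm q.[r%:C%C * t] <= _).
    by rewrite -lecR -!rnormE.
  by rewrite qtE; apply: le_trans (Fmax _ y0) _; rewrite FG; lra.
have {key} : ((r * w) ^+ p j) ^+ 2 <= (2 * rnorm b ^+ p j * rnorm y ^+ N) ^+ 2.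
  by rewrite lerXn2r ?nnegrE // ?exprn_ge0 ?mulr_ge0 ?exprn_ge0 ?rnorm_ge0 // ltW.
have -> : ((r * w) ^+ p j) ^+ 2 = (s * w) ^+ p j.
  by rewrite exprAC; congr (_ ^+ _); rewrite -r2; ring.
have -> : (2 * rnorm b ^+ p j * rnorm y ^+ N) ^+ 2 =
    4 * (rnorm b ^+ 2) ^+ p j * (1 + s) ^+ N.
  by rewrite -y2 -!exprM ![(2 * _)%N]mulnC !exprM; ring.
move=> key.
have eN : (1 + s) ^+ N <= expR 1 ^+ p j.
  have -> : expR 1 ^+ p j = expR s ^+ N :> R.
    rewrite -!expRM_natl; congr expR; rewrite mulr1 /s mulrC divfK //.
    by rewrite pnatr_eq0 -lt0n.
  by rewrite lerXn2r ?nnegrE ?expR_ge0 ?expR_ge1Dx //; lra.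
have sw_ge0 : 0 <= s * w by rewrite mulr_ge0 // ltW.
have rhs_ge0 : 0 <= 4 * expR 1 * rnorm b ^+ 2 by nra.
(* The 4, the square of the near-maximality factor 2, moves under the p_j-th power because p_j >=
   1. *)
rewrite -(@ler_pXn2r _ (p j)) ?nnegrE //; apply: le_trans key _.
rewrite [4 * expR 1 * _]mulrAC [leRHS]exprMn; apply: ler_pM => //.
- by rewrite mulr_ge0 // exprn_ge0.
- by rewrite exprn_ge0 // addr_ge0 // ltW.
by rewrite [leRHS]exprMn ler_wpM2r ?exprn_ge0 ?rnorm_ge0 ?ler_eXnr ?ler1n.
Qed.

(** Ball's theorem has the constant 1 in place of 4e + 1. Asking only |z| <= 1 lets z = 0 serve the
    empty family, where V may be trivial. *)
Lemma weak_complex_plank : exists2 z, rnorm z <= 1 & forall j,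
  (p j)%:R / N%:R * rnorm (x j) ^+ 2 <=
    (4 * expR 1 + 1) * rnorm (ip z (x j)) ^+ 2.
Proof.
have [n0|n_gt0] := posnP n.
  by exists 0 => [|j]; rewrite ?rnorm0 //;
    have := ltn_ord j; rewrite [X in (_ < X)%N]n0.
have [z [z1 Fz Fmax]] := near_maximizer_exists n_gt0.
by exists z => [|j]; [rewrite z1 | exact: near_maximizer_bound].
Qed.

End Plank.

(** * Limits of bounded complex sequences along an ultrafilter *)

Section UltraLimit.
Context {R : realType} (U : set_system nat) {FU : UltraFilter U}.
Local Open Scope classical_set_scope.

(** The image filter contains the compact segment [-M, M], so it clusters at some point, and a
    cluster point of an ultrafilter is a limit. *)
Lemma ultra_cvg_bounded (g : nat -> R) (M : R) :
  (forall n, `|g n| <= M) -> exists l : R, g n @[n --> U] --> l.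
Proof.
move=> gM; have gMM : fmap g U `[- M, M].
  by apply: (@filterE _ U) => n; rewrite /= in_itv /= -ler_norml; exact: gM.
have [l [_ lU]] := @segment_compact R (- M) M (fmap g U) _ gMM.
exists l => A lA; have [//|UA] := in_ultra_setVsetC (g @^-1` A) FU.
by have [y [/= nAy Ay]] := lU (~` A) A UA lA.
Qed.

Definition ulim (g : nat -> R[i]) (l : R[i]) :=
  (Re (g n) @[n --> U] --> Re l) /\ (Im (g n) @[n --> U] --> Im l).

Lemma ulim_exists g M : (forall n, rnorm (g n) <= M) -> exists l, ulim g l.
Proof.
move=> gM.
have [n|a ga] := @ultra_cvg_bounded (fun n => Re (g n)) M.
  exact: le_trans (ler_Re_rnorm _) (gM n).
have [n|b gb] := @ultra_cvg_bounded (fun n => Im (g n)) M.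
  exact: le_trans (ler_Im_rnorm _) (gM n).
by exists (Complex a b).
Qed.

Lemma ulim_unique g l m : ulim g l -> ulim g m -> l = m.
Proof.
case: l m => [a b] [c d] [/= ga gb] [/= gc gd].
by rewrite (cvg_unique _ ga gc) // (cvg_unique _ gb gd).
Qed.

Lemma ulim_linear (a : R[i]) g h l m :
  ulim g l -> ulim h m -> ulim (fun n => a * g n + h n) (a * l + m).
Proof.
case: a l m => [a b] [l l'] [m m'] [/= gl gl'] [/= hm hm']; split.
  rewrite (_ : (fun n => Re _) =
      (fun n => a * Re (g n)) - (fun n => b * Im (g n)) + (fun n => Re (h n))).
    exact: cvgD (cvgB (cvgMl_tmp gl) (cvgMl_tmp gl')) hm.
  by apply/funext => n; rewrite !fctE; case: (g n) => u v; case: (h n).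
rewrite (_ : (fun n => Im _) =
    (fun n => a * Im (g n)) + (fun n => b * Re (g n)) + (fun n => Im (h n))).
  exact: cvgD (cvgD (cvgMl_tmp gl') (cvgMl_tmp gl)) hm'.
by apply/funext => n; rewrite !fctE; case: (g n) => u v; case: (h n).
Qed.

Lemma ulim_rnorm g l : ulim g l -> rnorm (g n) ^+ 2 @[n --> U] --> rnorm l ^+ 2.
Proof.
move=> [gl gl']; rewrite rnorm_sqr !expr2.
rewrite (_ : (fun n => rnorm _ ^+ 2) =
    (fun n => Re (g n)) * (fun n => Re (g n)) +
    (fun n => Im (g n)) * (fun n => Im (g n))).
  exact: cvgD (cvgM gl gl) (cvgM gl' gl').
by apply/funext => n; rewrite !fctE rnorm_sqr !expr2.
Qed.

End UltraLimit.

(** * The plank theorem for a sequence of linearly growing vectors *)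

Lemma sum_invsqr_le (R : realType) (n : nat) :
  \sum_(k < n) ((k.+1)%:R ^- 2) <= 2 :> R.
Proof.
(* The slack makes the sum telescope: 1/y^2 <= 2/y - 2/(y + 1) for y >= 1. *)
suff : \sum_(k < n) ((k.+1)%:R ^- 2) <= 2 - 2 / n.+1%:R :> R.
  by move/le_trans; apply; rewrite lerBlDr lerDl divr_ge0.
elim: n => [|n IHn]; first by rewrite big_ord0 divr1 subrr.
rewrite big_ord_recr /=; apply: le_trans (lerD IHn (lexx _)) _.
have n1 : 0 < n.+1%:R :> R by rewrite ltr0n.
have n2 : n.+2%:R = n.+1%:R + 1 :> R by rewrite -natr1.
have n1_ge1 : 1 <= n.+1%:R :> R by rewrite ler1n.
rewrite n2; move: n.+1%:R n1 n1_ge1 => y y0 y1.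
rewrite -subr_ge0.
have -> : 2 - 2 / (y + 1) - (2 - 2 / y + y ^- 2) = (y - 1) / (y ^+ 2 * (y + 1)).
  by field; lra.
by rewrite divr_ge0 ?subr_ge0 // mulr_ge0 ?exprn_ge0 //; lra.
Qed.

Section WeakPlank.
Context {R : realType} {V : normedModType R[i]} {ip : V -> V -> R[i]}.
Hypothesis hip : is_inner_product ip.
Context {x : nat -> V} {c : R}.
Hypothesis c_gt0 : 0 < c.
Hypothesis x_ge : forall k, c * k.+1%:R ^+ 2 <= rnorm (x k) ^+ 2.

(** The weights 1/(k+1)^2 cancel the growth of |x_k|^2 and have sum at most 2, so the lower bound
    does not depend on [n]; this is what survives the passage to the limit. *)
Lemma finite_plank (n : nat) : exists z, rnorm z <= 1 /\ forall k, (k < n)%N ->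
  c / (2 * (4 * expR 1 + 1)) <= rnorm (ip z (x k)) ^+ 2.
Proof.
(* Scaling 1/(k+1)^2 by (n!)^2 turns the weights into integers. *)
pose p (k : 'I_n) := ((n`! %/ k.+1) ^ 2)%N.
pose D : R := n`!%:R ^+ 2.
have D_gt0 : 0 < D by rewrite exprn_gt0 // ltr0n fact_gt0.
have k1 (k : nat) : 0 < k.+1%:R ^+ 2 :> R by rewrite exprn_gt0 // ltr0n.
have pE k : (p k)%:R = D * k.+1%:R ^- 2 :> R.
  by rewrite /p natrX natf_div ?dvdn_fact //= exprMn exprVn.
have x_neq0 (k : 'I_n) : x k != 0.
  rewrite -rnorm_eq0 -sqrf_eq0 gt_eqF //; apply: lt_le_trans (x_ge k).
  exact: mulr_gt0.
have p_gt0 (k : 'I_n) : (0 < p k)%N.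
  by rewrite -(ltr0n R) pE mulr_gt0 // invr_gt0.
have [z z1 zx] := weak_complex_plank hip x_neq0 p_gt0.
exists z; split=> // k kn; have := zx (Ordinal kn); rewrite pE /=.
set N := (\sum_k p k)%N; set e := 4 * expR 1 + 1 => zk.
have N_le : N%:R <= 2 * D.
  rewrite natr_sum (eq_bigr _ (fun k _ => pE k)) -mulr_sumr mulrC.
  by rewrite ler_wpM2r ?(ltW D_gt0) // sum_invsqr_le.
have N_gt0 : 0 < N%:R :> R.
  by rewrite ltr0n /N (bigD1 (Ordinal kn)) //= ltn_addr.
have e_gt0 : 0 < e by have := expR_gt0 (1 : R); rewrite /e; lra.
have {zk} : c / 2 <= e * rnorm (ip z (x k)) ^+ 2.
  apply: le_trans zk; apply: (@le_trans _ _ (c * (D / N%:R))).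
    by rewrite ler_pM2l // ler_pdivlMr // mulrC ler_pdivrMr // mulrC.
  have -> : c * (D / N%:R) = D * k.+1%:R ^- 2 / N%:R * (c * k.+1%:R ^+ 2).
    by field; rewrite !gt_eqF // ltr0n.
  by rewrite ler_wpM2l // !mulr_ge0 ?invr_ge0 ?ltW.
by move=> ce; rewrite ler_pdivrMr ?mulr_gt0 //; lra.
Qed.

(** Each <x_k, z_n> is controlled only for n > k. The ultrafilter refines the eventual filter, so
    for fixed k this bound passes to the limit. *)
Lemma weak_plank_functional : exists f : V -> R[i], exists2 d : R, 0 < d &
  [/\ forall (a : R[i]) u v, f (a *: u + v) = a * f u + f v,
      forall v, rnorm (f v) <= rnorm v
    & forall k, d <= rnorm (f (x k))].
Proof.
have [z zP] := choice finite_plank.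
have [U [FU ooU]] := ultraFilterLemma (@eventually_filter).
have zip v n : rnorm (ip v (z n)) <= rnorm v.
  apply: le_trans (cauchy_schwarz hip _ _) _; rewrite -[leRHS]mulr1.
  by rewrite ler_wpM2l ?rnorm_ge0 //; case: (zP n).
have [f fP] := choice (fun v => @ulim_exists R U FU _ _ (zip v)).
pose b := c / (2 * (4 * expR 1 + 1)).
have b_gt0 : 0 < b.
  by rewrite divr_gt0 // mulr_gt0 // addr_gt0 // mulr_gt0 // expR_gt0.
have rn0 := fun v : V => rnorm_ge0 v.
exists f; exists (Num.sqrt b); rewrite ?sqrtr_gt0 //; split.
- move=> a u v; apply: ulim_unique (fP _) _.
  rewrite (_ : (fun n => _) = fun n => a * ip u (z n) + ip v (z n)).
    exact: ulim_linear.
  by apply/funext => n; rewrite (ipDl hip) (ipZl hip).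
- move=> v; rewrite -ler_sqr ?nnegrE ?rnorm_ge0 //.
  apply: cvgr_to_le (ulim_rnorm (fP v)) _; apply: (@filterE _ U) => n.
  by rewrite ler_sqr ?nnegrE ?rnorm_ge0.
- move=> k; rewrite -ler_sqr ?nnegrE ?rnorm_ge0 ?sqrtr_ge0 //.
  rewrite sqr_sqrtr ?(ltW b_gt0) //.
  apply: cvgr_to_ge (ulim_rnorm (fP (x k))) _; apply: ooU.
  by exists k.+1 => // n /= kn; rewrite (rnorm_ipC hip); case: (zP n) => _; apply.
Qed.
End WeakPlank.

(** * The Riesz representation theorem *)

Section Riesz.
Context {R : realType} {V : completeNormedModType R[i]} {ip : V -> V -> R[i]}.
Hypothesis hip : is_inner_product ip.
Context {f : V -> R[i]} {M : R}.
Hypothesis f_linear : forall (a : R[i]) u v, f (a *: u + v) = a * f u + f v.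
Hypothesis f_bounded : forall v, rnorm (f v) <= M * rnorm v.

Let f0 : f 0 = 0.
Proof. by have := f_linear (-1) 0 0; rewrite scaler0 addr0 mulN1r addNr. Qed.

Let fZ a u : f (a *: u) = a * f u.
Proof. by rewrite -[a *: u]addr0 f_linear f0 addr0. Qed.

Let fD u v : f (u + v) = f u + f v.
Proof. by rewrite -[u in LHS]scale1r f_linear mul1r. Qed.

(* The Riesz representative of f is the minimizer of J. *)
Let J v : R := rnorm v ^+ 2 - 2 * Re (f v).

Let J_ge v : - M ^+ 2 <= J v.
Proof.
have := le_trans (ler_norm _) (le_trans (ler_Re_rnorm (f v)) (f_bounded v)).
by have := sqr_ge0 (rnorm v - M); rewrite /J; nra.
Qed.

Let has_inf_J : has_inf (range J).
Proof.
split; first by exists (J 0); exists 0.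
by exists (- M ^+ 2) => _ [v _ <-].
Qed.

Let m := inf (range J).

Let m_le v : m <= J v.
Proof. by apply: inf_lbound; [case: has_inf_J | exists v]. Qed.

(** The parallelogram law, with J >= m at the midpoint of u and v. It makes minimizing sequences
    Cauchy. *)
Let J_dist u v : rnorm (u - v) ^+ 2 <= 2 * (J u + J v) - 4 * m.
Proof.
have := m_le ((2^-1)%:C%C *: (u + v)); have := parallelogram hip u v.
rewrite /J rnormZ rnorm_real fZ fD exprMn.
have -> : Re ((2^-1)%:C%C * (f u + f v)) = 2^-1 * (Re (f u) + Re (f v)).
  by case: (f u) => a b; case: (f v) => c d /=; ring.
by rewrite real_normK ?num_real //; lra.
Qed.

(** Moving from v along x by the optimal step d / |x|^2, where d is the difference of real parts,
    lowers J by d^2 / |x|^2. Near-minimality allows a drop of at most e. *)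
Let J_near_min v e x : J v < m + e ->
  (Re (f x) - Re (ip x v)) ^+ 2 <= e * rnorm x ^+ 2.
Proof.
move=> Jv; have [->|x0] := eqVneq x 0.
  by rewrite f0 (ip0l hip) subrr rnorm0 expr0n mulr0.
have X_gt0 : 0 < rnorm x ^+ 2 by rewrite exprn_gt0 ?rnorm_gt0.
have Jt (t : R) : J (v + t%:C%C *: x) =
    J v + t ^+ 2 * rnorm x ^+ 2 - 2 * t * (Re (f x) - Re (ip x v)).
  rewrite /J (sqr_rnormD hip) rnormZ rnorm_real fD fZ (ipZr hip) exprMn.
  rewrite real_normK ?num_real // (ipC hip x).
  by case: (f v) (f x) (ip x v) => a b [c d] [a' b'] /=; ring.
set d := _ - _ in Jt *.
have := m_le (v + (d / rnorm x ^+ 2)%:C%C *: x); rewrite Jt => mJ.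
rewrite -ler_pdivrMr //.
suff : d ^+ 2 / rnorm x ^+ 2 =
    2 * (d / rnorm x ^+ 2) * d - (d / rnorm x ^+ 2) ^+ 2 * rnorm x ^+ 2 by lra.
by field; rewrite rnorm_eq0.
Qed.

Lemma riesz_representation : exists z, forall x, f x = ip x z.
Proof.
have inv_gt0 n : 0 < n.+1%:R^-1 :> R by rewrite invr_gt0 ltr0n.
have zex n : exists z, J z < m + n.+1%:R^-1.
  by have [_ [z _ <-] Jz] := inf_adherent (inv_gt0 n) has_inf_J; exists z.
have [z zP] := choice zex.
(* The 4 comes from [J_dist]: points with J below m + 1/(N+1) have squared distance below
   4/(N+1). *)
have small (e : R) : 0 < e ->
    exists N, forall n, (N <= n)%N -> 4 * n.+1%:R^-1 < e.
  move=> e_gt0; exists (Num.truncn (4 / e)) => n Nn.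
  rewrite ltr_pdivrMr ?ltr0n // mulrC -ltr_pdivrMr //.
  by apply: lt_le_trans (truncnS_gt _) _; rewrite ler_nat ltnS.
have zC : cauchy (z n @[n --> \oo])%classic.
  apply: cauchy_exP => e e_gt0.
  have eE : e = (Re e)%:C%C by rewrite RRe_real // gtr0_real.
  have Re_gt0 : 0 < Re e by rewrite -ltcR -eE.
  have [N NP] := small _ (exprn_gt0 2 Re_gt0).
  exists (z N); exists N => // n /= Nn.
  rewrite -ball_normE /ball_ /= eE rnormE ltcR.
  rewrite -ltr_sqr ?nnegrE ?rnorm_ge0 ?ltW //; apply: le_lt_trans (J_dist _ _) _.
  apply: le_lt_trans (NP N (leqnn N)).
  have : n.+1%:R^-1 <= N.+1%:R^-1 :> R by rewrite lef_pV2 ?posrE ?ltr0n ?ler_nat.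
  move: (zP N) (zP n); move: (J _) (J _) N.+1%:R^-1 n.+1%:R^-1 m => *.
  lra.
have /cauchy_cvgP/cvg_ex[l zl] := zC.
exists l.
have ReE x : Re (f x) = Re (ip x l).
  apply/eqP; rewrite -subr_eq0; apply: contraT => d0.
  set d := _ - _ in d0; have d_gt0 : 0 < `|d| by rewrite normr_gt0.
  have X1_gt0 : 0 < rnorm x + 1 by rewrite ltr_wpDl ?rnorm_ge0.
  (* Splits d into a minimality defect at z_n, below |d|/2, and <x, z_n - l>, at most |d|/2, which
     is absurd. Adding 1 to |x| covers x = 0. *)
  pose e := `|d| / 2 / (rnorm x + 1).
  have e_gt0 : 0 < e by rewrite !divr_gt0.
  have [N NP] := small _ (exprn_gt0 2 e_gt0).
  have /cvgrPdist_lt/(_ e%:C%C) := zl; rewrite ltcR => /(_ e_gt0) [N' _ N'P].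
  pose n := maxn N N'.
  have := N'P n (leq_maxr _ _); rewrite /= rnormE ltcR rnormB => zn_l.
  have f_zn := J_near_min x (zP n).
  have dE : d = (Re (f x) - Re (ip x (z n))) + Re (ip x (z n - l)).
    rewrite /d (ipBr hip).
    by case: (f x) (ip x (z n)) (ip x l) => a b [a' b'] [a'' b''] /=; ring.
  have lt1 : `|Re (f x) - Re (ip x (z n))| < `|d| / 2.
    rewrite -ltr_sqr ?nnegrE ?divr_ge0 // real_normK ?num_real //.
    apply: le_lt_trans f_zn _; have := NP n (leq_maxl _ _).
    have -> : `|d| / 2 = e * (rnorm x + 1) by rewrite /e divfK ?gt_eqF.
    move=> ne; apply: le_lt_trans (_ : _ <= n.+1%:R^-1 * (rnorm x + 1) ^+ 2) _.
      by rewrite ler_pM2l // ler_sqr ?nnegrE ?rnorm_ge0 ?lerDl // ltW.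
    rewrite [ltRHS]exprMn ltr_pM2r ?exprn_gt0 //; apply: le_lt_trans ne.
    by rewrite ler_peMl ?ler1n // ltW.
  have le2 : `|Re (ip x (z n - l))| <= `|d| / 2.
    apply: le_trans (ler_Re_rnorm _) _; apply: le_trans (cauchy_schwarz hip _ _) _.
    have -> : `|d| / 2 = (rnorm x + 1) * e by rewrite [RHS]mulrC /e divfK ?gt_eqF.
    by rewrite ler_pM ?rnorm_ge0 ?lerDl ?ltW.
  have := ler_normD (Re (f x) - Re (ip x (z n))) (Re (ip x (z n - l))).
  by rewrite -dE; lra.
(* J sees only real parts; the imaginary part of f x is recovered from Re (f (i x)) = - Im (f x). *)
move=> x; have := ReE x; have := ReE ('i%C *: x); rewrite fZ (ipZl hip).
case: (f x) (ip x l) => a b [c d] /=; rewrite !mul0r !mul1r !sub0r.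
by move=> /oppr_inj -> ->.
Qed.

End Riesz.

(** * Scalar functionals along a weakly hypercyclic orbit *)

Section Orbit.
Context {R : realType} {V : normedModType R[i]}.

Lemma continuous_linear_rnorm_bounded (f : {linear V -> V}) :
  continuous f -> exists2 M, 0 <= M & forall v, rnorm (f v) <= M * rnorm v.
Proof.
move=> /linear_bounded_continuous /linear_boundedP [r [rR rP]].
have r1 : r < r + 1 by rewrite ltrDl.
exists `|Re (r + 1)| => // v; have := rP _ r1 v.
have -> : r + 1 = (Re (r + 1))%:C%C by rewrite RRe_real // realD ?real1.
rewrite !rnormE -rmorphM lecR => /le_trans; apply.
by rewrite ler_wpM2r ?rnorm_ge0 ?ler_norm.
Qed.

(** A nonzero scalar functional is onto, so viewed as a 1 x 1 row it is an admissible [L]. This form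
    spares later steps any matrices. *)
Lemma weakly_hypercyclic_orbit (T : V -> V) (x : V) (f : V -> R[i]) (M : R) :
  (forall L : {linear V -> 'rV[R[i]^o]_1}, continuous L ->
    (forall y, exists v, L v = y) ->
    dense (range (fun m : nat => L (iter m T x)))) ->
  (forall (a : R[i]) u v, f (a *: u + v) = a * f u + f v) ->
  (forall v, rnorm (f v) <= M * rnorm v) ->
  (exists v, f v != 0) ->
  forall (c : R[i]) (e : R), 0 < e ->
  exists m, rnorm (f (iter m T x) - c) < e.
Proof.
move=> Tx f_linear f_bounded [v0 fv0] c e e_gt0.
pose g v : 'rV[R[i]^o]_1 := const_mx (f v).
have g_linear : linear g by move=> a u v; apply/rowP => i; rewrite !mxE f_linear.
pose L : {linear V -> 'rV[R[i]^o]_1} :=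
  HB.pack g (GRing.isLinear.Build _ _ _ _ g g_linear).
have Lg v : L v = g v by [].
have L_le v : `|L v| <= `|f v|.
  suff : mx_norm (g v) <= `|f v| by [].
  by have [->|/mx_norm_neq0[i ->]] := eqVneq (mx_norm (g v)) 0; rewrite ?mxE.
have L_cont : continuous L.
  apply/linear_bounded_continuous/linear_boundedP.
  exists M%:C%C; split; first by apply/complex_realP; exists M.
  move=> r Mr v; apply: le_trans (L_le v) _.
  apply: (@le_trans _ _ (M%:C%C * `|v|)); last by rewrite ler_wpM2r // ltW.
  by rewrite !rnormE -rmorphM lecR.
have L_surj y : exists v, L v = y.
  exists ((y 0 0 / f v0) *: v0); apply/rowP => i; rewrite Lg !mxE ord1.
  have f0 : f 0 = 0.
    by have := f_linear (-1) 0 0; rewrite scaler0 addr0 mulN1r addNr.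
  by rewrite -[_ *: v0]addr0 f_linear f0 addr0 divfK.
pose B := ball (const_mx c : 'rV[R[i]^o]_1) e%:C%C.
have eC_gt0 : 0 < e%:C%C :> R[i] by rewrite ltcR.
have B0 : (B^° !=set0)%classic.
  by exists (const_mx c); exact: nbhsx_ballx.
have [y [By [m _ Ly]]] := Tx L L_cont L_surj _ B0 (@open_interior _ B).
exists m; have /interior_subset := By; rewrite -Ly => -[_ /(_ 0 0)].
by rewrite Lg !mxE -ball_normE /ball_ /= rnormE ltcR rnormB.
Qed.

End Orbit.

Lemma iter_comm (X : Type) (T S : X -> X) (n : nat) (x : X) :
  (forall v, T (S v) = S (T v)) -> S (iter n T x) = iter n T (S x).
Proof. by move=> TS; elim: n => //= n <-; rewrite TS. Qed.

(** * Growth of orbits *)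

Section Growth.
Context {R : realType} {V : normedModType R[i]}.

(** Each step adds |S T^n x|^2 = |T^n S x|^2, which is at least |S x|^2 because T does not decrease
    norms. *)
Lemma iter_linear_growth (T S : V -> V) (x : V) (n : nat) :
  (forall v, T (S v) = S (T v)) ->
  (forall v, rnorm (S v) ^+ 2 + rnorm v ^+ 2 <= rnorm (T v) ^+ 2) ->
  rnorm x ^+ 2 + n%:R * rnorm (S x) ^+ 2 <= rnorm (iter n T x) ^+ 2.
Proof.
move=> TS TSle.
have iter_ge k v : rnorm v ^+ 2 <= rnorm (iter k T v) ^+ 2.
  elim: k => //= k IHk; apply: le_trans IHk _; apply: le_trans (TSle _).
  by rewrite lerDr sqr_ge0.
elim: n => [|n IHn]; first by rewrite mul0r addr0.
apply: le_trans (TSle _); rewrite (iter_comm n x TS) -natr1.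
by have := iter_ge n (S x); lra.
Qed.

(** The linear bound at S x makes the n-th increment at least n |S^2 x|^2, and 0 + 1 + ... + (n-1) =
    n(n-1)/2. *)
Lemma iter_quadratic_growth (T S : V -> V) (x : V) (n : nat) :
  (forall v, T (S v) = S (T v)) ->
  (forall v, rnorm (S v) ^+ 2 + rnorm v ^+ 2 <= rnorm (T v) ^+ 2) ->
  rnorm x ^+ 2 + n%:R * (n%:R - 1) / 2 * rnorm (S (S x)) ^+ 2 <=
    rnorm (iter n T x) ^+ 2.
Proof.
move=> TS TSle.
elim: n => [|n IHn]; first by rewrite !mul0r addr0.
apply: le_trans (TSle _); rewrite (iter_comm n x TS) -natr1.
have := @iter_linear_growth T S (S x) n TS TSle.
have := sqr_ge0 (rnorm (S x)); lra.
Qed.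
End Growth.

(** * Exclusion of weak hypercyclicity *)

Theorem theorem1p8 (R : realType) (V : completeNormedModType R[i])
  (ip : V -> V -> R[i]) (hip : is_inner_product ip)
  (T : {linear V -> V}) (hT : continuous T) :
  (exists S : {linear V -> V},
     [/\ continuous S,
         S \o S <> (fun _ => 0),
         T \o S = S \o T
       & forall x : V,
           0 <= ip (adjoint ip T (T x) - (adjoint ip S (S x) + x)) x]) ->
  ~ n_weakly_hypercyclic 1 T.
Proof.
move=> [S [S_cont S2_neq0 TS_comm TS_ge]] [x Tx].
have TS v : T (S v) = S (T v) by have := congr1 (@^~ v) TS_comm.
have [M M_ge0 MS] := continuous_linear_rnorm_bounded S_cont.
(* For S the default value 0 of [adjoint] must be ruled out: the Riesz vector of u -> <S u, S v>
   shows that the defining set is nonempty. *)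
have adjS v : ip (adjoint ip S (S v)) v = ip (S v) (S v).
  have [a u w|u|z zP] := @riesz_representation _ _ _ hip
      (fun u => ip (S u) (S v)) (M * rnorm (S v)).
  - by rewrite linearP (ipDl hip) (ipZl hip).
  - apply: le_trans (cauchy_schwarz hip _ _) _; rewrite mulrAC.
    by rewrite ler_wpM2r ?rnorm_ge0.
  rewrite /adjoint; case: xgetP => [w _ wP|/(_ z)]; last by case.
  by rewrite (ipC hip v) -wP -(ipC hip).
(* Where the adjoint of T is undefined, xget returns 0; the hypothesis then
   forces S v = v = 0, so that no Riesz representation is needed for T. *)
have adjT v : adjoint ip T (T v) = 0 \/
    ip (adjoint ip T (T v)) v = ip (T v) (T v).
  rewrite /adjoint; case: xgetP => [w _ wP|_]; [right | by left].
  by rewrite (ipC hip v) -wP -(ipC hip).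
have TS_le v : rnorm (S v) ^+ 2 + rnorm v ^+ 2 <= rnorm (T v) ^+ 2.
  have := TS_ge v; rewrite (ipBl hip) (ipDl hip) adjS.
  case: (adjT v) => ->; rewrite ?(ip0l hip) !(ipxx hip).
    rewrite sub0r -rmorphD -rmorphN ler0c oppr_ge0.
    by move/le_trans; apply; exact: sqr_ge0.
  by rewrite -rmorphD -rmorphB ler0c subr_ge0.
have [w w0] : exists w, S (S w) != 0.
  apply: contrapT => SS0; apply: S2_neq0; apply/funext => v /=.
  by apply/eqP/negPn/negP => SSv; apply: SS0; exists v.
(* If S^2 x = 0, the functional vanishes on the whole orbit, which therefore stays at distance 1
   from the target 1. *)
have [SSx|SSx] := eqVneq (S (S x)) 0.
  have [||||m] := @weakly_hypercyclic_orbit _ _ T x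
    (fun v => ip (S (S v)) (S (S w))) (M * M * rnorm (S (S w))) Tx _ _ _ 1 1.
  - by move=> a u v; rewrite !linearP (ipDl hip) (ipZl hip).
  - move=> v; apply: le_trans (cauchy_schwarz hip _ _) _; rewrite mulrAC.
    rewrite ler_wpM2r ?rnorm_ge0 //; apply: le_trans (MS _) _.
    by rewrite -mulrA ler_wpM2l.
  - exists w; rewrite (ipxx hip) (inj_eq (@complexI R) _ 0).
    by rewrite expf_eq0 rnorm_eq0.
  - exact: ltr01.
  have iter0 : iter m T 0 = 0 by elim: (m) => //= k ->; rewrite linear0.
  by rewrite !(iter_comm _ _ TS) SSx iter0 (ip0l hip) sub0r rnormN rnorm1 ltxx.
have x_neq0 : x != 0 by apply: contra_neq SSx => ->; rewrite !linear0.
(* With both squared norms at least 8c, the growth bound is at least c (4k^2 - 4k + 8), which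
   exceeds c (k+1)^2 by c (3 (k-1)^2 + 4). *)
pose c := Num.min (rnorm x ^+ 2) (rnorm (S (S x)) ^+ 2) / 8.
have c_gt0 : 0 < c by rewrite divr_gt0 // lt_min !exprn_gt0 ?rnorm_gt0.
have iter_ge k : c * k.+1%:R ^+ 2 <= rnorm (iter k T x) ^+ 2.
  apply: le_trans (iter_quadratic_growth x k TS TS_le).
  have cx : 8 * c <= rnorm x ^+ 2 by rewrite mulrC divfK // ge_min lexx.
  have cS : 8 * c <= rnorm (S (S x)) ^+ 2.
    by rewrite mulrC divfK // ge_min lexx orbT.
  (* This uses that k is an integer, so it is recorded before k is generalized to a real t. *)
  have k_ge0 : 0 <= k%:R * (k%:R - 1) :> R.
    by case: (k) => [|j]; rewrite ?mul0r // mulr_ge0 // subr_ge0 ler1n.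
  rewrite -natr1; move: (k%:R) k_ge0 => t t_ge0.
  have := sqr_ge0 (t - 1); nra.
have [f [d d_gt0 [f_linear f_bounded fx]]] :=
  weak_plank_functional hip c_gt0 iter_ge.
have [||m] := @weakly_hypercyclic_orbit _ _ T x f 1 Tx f_linear _ _ 0 d d_gt0.
- by move=> v; rewrite mul1r.
- exists x; rewrite -rnorm_gt0; exact: lt_le_trans (fx 0%N).
by rewrite subr0 ltNge fx.
Qed.
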